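(* Let $0<p<1/2$, let $c>0$ be a constant, and let $n$ be such that $k=c\log_2 n$ is an integer with $k\ge 2$. Let $s\in\{0,1\}^n$ be an arbitrary (unknown) source string, let $x\in\{0,1\}^k$, and let $i\in\{1,\dots,n-k+1\}$. Let $\epsilon_n>0$ and $\delta\in(0,1)$. (1) There is an estimator $\hat K_{s,x}[i]$, computed from $T$ independent traces of $s$, such that if $T\ge \ln\!\left(\frac{2}{\delta}\right)\epsilon_n^{-2} f_c(n)$ then $|\hat K_{s,x}[i]-K_{s,x}[i]|<\epsilon_n$ with probability at least $1-\delta$. (2) There is an estimator $\hat K_s$ of the whole $k$-mer density map, computed from $T$ independent traces of $s$, such that if $T\ge \ln\!\left(\frac{2n^{1+c}}{\delta}\right)\epsilon_n^{-2} f_c(n)$ then $\|\hat K_s-K_s\|_\infty<\epsilon_n$ with probability at least $1-\delta$.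
   Context: Deletion channel: for $s\in\{0,1\}^n$ and deletion probability $p\in[0,1)$, a trace $\tilde S$ of $s$ is the (possibly shorter) string obtained by deleting each bit of $s$ independently with probability $p$; distinct traces are independent. Strings are indexed from 1 and $s[a:b]=(s[a],\dots,s[b])$. For $x\in\{0,1\}^k$ and $i\in\{1,\dots,n-k+1\}$, the $k$-mer density is $K_{s,x}[i]=\sum_{j=1}^{n-k+1}\binom{j-1}{i-1}(1-p)^{i-1}p^{j-i}\,\mathbb 1\{s[j:j+k-1]=x\}$ (with $\binom{j-1}{i-1}=0$ if $j<i$). The $k$-mer density map $K_s$ is the vector obtained by concatenating $K_{s,x}$ over all $x\in\{0,1\}^k$, and $\|\cdot\|_\infty$ is the max of absolute values of entries. $H(q)=-q\log_2 q-(1-q)\log_2(1-q)$ is the binary entropy. Define $\alpha_c(p)=1+c\log_2\!\frac{1-p}{p}+\frac{cH\left(1-\frac{p}{1-p}\right)+c\log_2\frac{p}{1-p}}{1-\frac{p}{1-p}}$ and $f_c(n)=\frac{\left(1+2n^{\alpha_c(p)}\right)^2}{2\,n^{2c\log_2(1-p)-1}}$. *)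

(* Defs.v *)
From HB Require Import structures.
From mathcomp Require Import all_boot all_order all_algebra.
From mathcomp Require Import all_classical all_reals all_analysis.
Set Implicit Arguments. Unset Strict Implicit. Unset Printing Implicit Defensive.
Import Order.TTheory GRing.Theory Num.Theory.
Local Open Scope ring_scope.

Section Defs.
Variable R : realType.

Definition log2 (x : R) : R := ln x / ln 2.

Definition Hbin (q : R) : R := - q * log2 q - (1 - q) * log2 (1 - q).

Definition alpha_c (c p : R) : R :=
  1 + c * log2 ((1 - p) / p)
  + (c * Hbin (1 - p / (1 - p)) + c * log2 (p / (1 - p))) / (1 - p / (1 - p)).

Definition f_c (c p : R) (n : nat) : R :=
  (1 + 2 * (n%:R `^ alpha_c c p)) ^+ 2
  / (2 * (n%:R `^ (2 * c * log2 (1 - p) - 1))).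

(* k-mer density K_{s,x}[i], with i 1-indexed; s[j:j+k-1] = take k (drop (j-1) s).
   The summand for j < i vanishes since 'C(j-1,i-1) = 0. *)
Definition kmer_density (p : R) (n k : nat) (s : n.-tuple bool)
    (x : k.-tuple bool) (i : nat) : R :=
  \sum_(1 <= j < (n.+1 - k).+1)
     'C(j - 1, i - 1)%:R * (1 - p) ^+ (i - 1) * p ^+ (j - i)
     * (take k (drop (j - 1) s) == x)%:R.

(* Deletion channel: a mask m (true = bit kept) produces the trace mask m s.
   Each bit is deleted independently with probability p. *)
Definition trace_of (n : nat) (s : n.-tuple bool) (m : n.-tuple bool) : seq bool :=
  mask m s.

Definition mask_weight (p : R) (n : nat) (m : n.-tuple bool) : R :=
  \prod_(j < n) (if tnth m j then 1 - p else p).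

Definition traces_of (n T : nat) (s : n.-tuple bool)
    (M : {ffun 'I_T -> n.-tuple bool}) : seq (seq bool) :=
  [seq trace_of s (M t) | t <- enum 'I_T].

Definition trace_prob (p : R) (n T : nat) (s : n.-tuple bool)
    (E : seq (seq bool) -> bool) : R :=
  \sum_(M : {ffun 'I_T -> n.-tuple bool})
     (\prod_(t < T) mask_weight p (M t)) * (E (traces_of s M))%:R.

End Defs.

(* Main.v *)
(* Put q = - p / (1 - p).  For a single trace, weight every occurrence of x as
   a subsequence starting exactly at position i by q ^ (number of skipped
   letters), sum, and divide by (1 - p) ^ k.  In expectation over the channel
   each source letter lying strictly inside an occurrence contributes a factor
   p + (1 - p) q = 0, so only contiguous occurrences in s survive and the
   estimator is unbiased for K_{s,x}[i].  Since |q| < 1 it is bounded by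
   W = ((1 - p) (1 - |q|)) ^ (- k) = (1 - 2 p) ^ (- k).  Averaging over the traces,
   a Hoeffding bound with tail 2 exp (- T eps^2 / (16 W^2)) suffices, because
   n ^ alpha_c = n ((1 - p) / (1 - 2 p)) ^ k gives f_c >= 2 n^3 W^2 >= 16 W^2.
   Part (2) is a union bound over at most 2 ^ k * n = n ^ (1 + c) entries. *)
Require Import Defs.
From HB Require Import structures.
From mathcomp Require Import all_boot all_order all_algebra.
From mathcomp Require Import all_classical all_reals all_analysis.
From mathcomp Require Import ring lra zify.
Import Order.TTheory GRing.Theory Num.Theory.
Local Open Scope ring_scope.

(** * Exponential moments and a two-sided Hoeffding bound *)

(** From [1 - v <= expR (- v)] one gets [expR (2 * v) * (1 - v) ^+ 2 <= 1] for small [v]. Taking [v]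
    to be [u / 2] and [- (u / 2)] replaces both exponentials by rational functions, and a polynomial
    inequality remains. *)
Lemma cosh_le_small (R : realType) (u : R) : u ^+ 2 <= 2^-1 ->
  (expR u + expR (- u)) / 2 <= expR (u ^+ 2).
Proof.
move=> hu; apply: le_trans (expR_ge1Dx _).
set h := u / 2.
have uE : u = 2 * h by rewrite /h; field.
have h8 : h ^+ 2 <= 8^-1 by rewrite uE in hu; nra.
have key (v : R) : v ^+ 2 <= 8^-1 -> expR (2 * v) * (1 - v) ^+ 2 <= 1.
  move=> hv.
  have v1 : 0 <= 1 - v by nra.
  have ev := expR_ge1Dx (- v).
  have e1 : expR (2 * v) * expR (- v) ^+ 2 = 1.
    by rewrite -expRM_natl -expRD -[RHS]expR0; congr expR; ring.
  rewrite -[leRHS]e1 ler_wpM2l ?expR_ge0//; nra.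
have k1 := key h h8.
have k2 : expR (2 * - h) * (1 - - h) ^+ 2 <= 1 by apply: key; rewrite sqrrN.
rewrite uE -mulrN.
move: k1 k2; set X := expR _; set Y := expR _ => k1 k2.
have q0 : 0 < (1 - h ^+ 2) ^+ 2 by rewrite exprn_gt0//; lra.
rewrite ler_pdivrMr// -(ler_pM2r q0).
have s1 : X * (1 - h ^+ 2) ^+ 2 <= (1 + h) ^+ 2.
  have -> : X * (1 - h ^+ 2) ^+ 2 = (X * (1 - h) ^+ 2) * (1 + h) ^+ 2 by ring.
  by rewrite ler_piMl ?sqr_ge0.
have s2 : Y * (1 - h ^+ 2) ^+ 2 <= (1 - h) ^+ 2.
  have -> : Y * (1 - h ^+ 2) ^+ 2 = (Y * (1 - - h) ^+ 2) * (1 - h) ^+ 2 by ring.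
  by rewrite ler_piMl ?sqr_ge0.
(* With z = h^2, half the difference of the two sides is z (1 - 7 z + 4 z^2), nonnegative because z
   <= 1/8. *)
have : (1 + h) ^+ 2 + (1 - h) ^+ 2 <= (1 + (2 * h) ^+ 2) * 2 * (1 - h ^+ 2) ^+ 2.
  have h0 : 0 <= h ^+ 2 by rewrite sqr_ge0.
  have : 0 <= h ^+ 2 * (1 - 7 * h ^+ 2 + 4 * h ^+ 2 * h ^+ 2).
    by rewrite mulr_ge0//; nra.
  nra.
by rewrite mulrDl; lra.
Qed.

(* The estimate near 0 extends to the whole line by the doubling inequality
   [cosh (2 v) = 2 cosh(v)^2 - 1 <= cosh(v)^4]. *)
Lemma cosh_le (R : realType) (u : R) :
  (expR u + expR (- u)) / 2 <= expR (u ^+ 2).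
Proof.
have dbl m : forall v : R, v ^+ 2 <= 4 ^+ m / 2 ->
    (expR v + expR (- v)) / 2 <= expR (v ^+ 2).
  elim: m => [|m IHm] v hv; first by apply: cosh_le_small; rewrite expr0 in hv; lra.
  have vE : v = 2 * (v / 2) by field.
  have {}IHm : (expR (v / 2) + expR (- (v / 2))) / 2 <= expR ((v / 2) ^+ 2).
    apply: IHm; have -> : (v / 2) ^+ 2 = v ^+ 2 / 4 by field.
    by move: hv; rewrite (exprS 4); lra.
  have -> : expR (v ^+ 2) = expR ((v / 2) ^+ 2) ^+ 4.
    by rewrite -expRM_natl; congr expR; field.
  have -> : expR v = expR (v / 2) ^+ 2 by rewrite -expRM_natl -vE.
  have -> : expR (- v) = expR (- (v / 2)) ^+ 2.
    by rewrite -expRM_natl mulrN -vE.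
  have XY : expR (v / 2) * expR (- (v / 2)) = 1 by rewrite -expRD subrr expR0.
  have X0 : 0 <= expR (v / 2) by exact: expR_ge0.
  have Y0 : 0 <= expR (- (v / 2)) by exact: expR_ge0.
  move: XY X0 Y0 IHm.
  set X := expR (v / 2); set Y := expR (- (v / 2)); set Z := expR _.
  move=> XY X0 Y0 XYZ.
  have c0 : 0 <= (X + Y) / 2 by rewrite divr_ge0// addr_ge0.
  apply: (@le_trans _ _ (((X + Y) / 2) ^+ 4)); last first.
    by rewrite lerXn2r ?nnegrE//; apply: le_trans XYZ.
  have -> : (X ^+ 2 + Y ^+ 2) / 2 = 2 * ((X + Y) / 2) ^+ 2 - 1.
    by rewrite -[X in _ = _ - X]XY; field.
  have := sqr_ge0 (((X + Y) / 2) ^+ 2 - 1); set c := (X + Y) / 2 => hc.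
  have -> : c ^+ 4 = (c ^+ 2 - 1) ^+ 2 + (2 * c ^+ 2 - 1) by ring.
  by rewrite lerDr.
have [m hm] : exists m : nat, u ^+ 2 * 2 <= 4 ^+ m.
  exists (Num.trunc (u ^+ 2 * 2)).+1.
  apply: le_trans (ltW (truncnS_gt _)) _.
  by rewrite -natrX ler_nat ltnW// ltn_expl.
by apply: (dbl m); rewrite ler_pdivlMr.
Qed.

Lemma expR_chord (R : realType) (b y : R) : `|y| <= b ->
  2 * b * expR y <= (b + y) * expR b + (b - y) * expR (- b).
Proof.
rewrite ler_norml => /andP[yl yu].
(* tangent of [expR] at [y], evaluated at the two end points *)
have tangent (z : R) : expR y * (1 + (z - y)) <= expR z.
  rewrite -[in leRHS](subrKC y z) expRD ler_wpM2l ?expR_ge0//.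
  exact: expR_ge1Dx.
have h1 : (b + y) * (expR y * (1 + (b - y))) <= (b + y) * expR b.
  by rewrite ler_wpM2l ?tangent//; lra.
have h2 : (b - y) * (expR y * (1 + (- b - y))) <= (b - y) * expR (- b).
  by rewrite ler_wpM2l ?tangent//; lra.
(* The slope terms (b + y)(b - y) and (b - y)(- b - y) cancel in the sum. *)
apply: le_trans (lerD h1 h2).
by rewrite le_eqVlt; apply/orP; left; apply/eqP; ring.
Qed.

(** Averaging the chord bound kills its linear part, since [Y] has mean zero, and leaves cosh b. *)
Lemma mgf_le (R : realType) (I : finType) (w Y : I -> R) (b : R) :
  (forall i, 0 <= w i) -> \sum_i w i = 1 -> \sum_i w i * Y i = 0 ->
  0 < b -> (forall i, `|Y i| <= b) ->
  \sum_i w i * expR (Y i) <= expR (b ^+ 2).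
Proof.
move=> w0 w1 wY b0 Yb; apply: le_trans (cosh_le _ b).
rewrite -(@ler_pM2l _ (2 * b)) ?mulr_gt0//.
apply: (@le_trans _ _
  (\sum_i (w i * (b * (expR b + expR (- b))) + w i * Y i * (expR b - expR (- b))))).
  rewrite mulr_sumr; apply: ler_sum => i _.
  have := ler_wpM2l (w0 i) (expR_chord _ _ _ (Yb i)); lra.
rewrite big_split/= -!mulr_suml w1 wY mul0r addr0.
by rewrite le_eqVlt; apply/orP; left; apply/eqP; field.
Qed.

Lemma hoeffding_upper (R : realType) (I : finType) (w Y : I -> R) (b eps : R)
    (T : nat) :
  (forall i, 0 <= w i) -> \sum_i w i = 1 -> \sum_i w i * Y i = 0 ->
  0 < b -> (forall i, `|Y i| <= b) -> 0 < eps ->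
  \sum_(M : {ffun 'I_T -> I}) (\prod_t w (M t)) *
     (T%:R * eps <= \sum_t Y (M t))%R%:R
  <= expR (- (T%:R * eps ^+ 2 / (4 * b ^+ 2))).
Proof.
move=> w0 w1 wY b0 Yb e0.
(* Chernoff parameter: the minimiser of l^2 b^2 - l eps, with minimum - eps^2 / (4 b^2). *)
pose l := eps / (2 * b ^+ 2).
have l0 : 0 < l by rewrite divr_gt0// mulr_gt0// exprn_gt0.
have bn0 : b != 0 by rewrite gt_eqF.
have W0 (M : {ffun 'I_T -> I}) : 0 <= \prod_t w (M t) by exact: prodr_ge0.
apply: (@le_trans _ _ (\sum_(M : {ffun 'I_T -> I})
    expR (- (l * (T%:R * eps))) * \prod_t (w (M t) * expR (l * Y (M t))))).
  apply: ler_sum => M _.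
  rewrite big_split/= mulrCA ler_wpM2l// -expR_sum -expRD.
  have [h|_] := leP (T%:R * eps); last exact: expR_ge0.
  rewrite -[leLHS]expR0 ler_expR -mulr_sumr addrC subr_ge0.
  by rewrite ler_wpM2l// ltW.
rewrite -mulr_sumr -(bigA_distr_bigA (fun _ i => w i * expR (l * Y i))).
rewrite prodr_const card_ord.
have mgf : \sum_i w i * expR (l * Y i) <= expR ((l * b) ^+ 2).
  apply: mgf_le => //.
  - by under eq_bigr do rewrite mulrCA; rewrite -mulr_sumr wY mulr0.
  - exact: mulr_gt0.
  - by move=> i; rewrite normrM gtr0_norm// ler_wpM2l// ltW.
apply: (@le_trans _ _ (expR (- (l * (T%:R * eps))) * expR ((l * b) ^+ 2) ^+ T)).
  rewrite ler_wpM2l ?expR_ge0// lerXn2r ?nnegrE ?expR_ge0//.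
  by apply: sumr_ge0 => i _; rewrite mulr_ge0 ?expR_ge0.
rewrite -expRM_natl -expRD ler_expR le_eqVlt; apply/orP; left; apply/eqP.
by rewrite /l; field.
Qed.

Lemma hoeffding (R : realType) (I : finType) (w Y : I -> R) (b eps : R)
    (T : nat) :
  (forall i, 0 <= w i) -> \sum_i w i = 1 -> \sum_i w i * Y i = 0 ->
  0 < b -> (forall i, `|Y i| <= b) -> 0 < eps ->
  \sum_(M : {ffun 'I_T -> I}) (\prod_t w (M t)) *
     (T%:R * eps <= `|\sum_t Y (M t)|)%R%:R
  <= 2 * expR (- (T%:R * eps ^+ 2 / (4 * b ^+ 2))).
Proof.
move=> w0 w1 wY b0 Yb e0.
have up := hoeffding_upper _ _ _ _ _ _ T w0 w1 wY b0 Yb e0.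
have : \sum_(M : {ffun 'I_T -> I}) (\prod_t w (M t)) *
     (T%:R * eps <= \sum_t (- Y (M t)))%R%:R
  <= expR (- (T%:R * eps ^+ 2 / (4 * b ^+ 2))).
  apply: (@hoeffding_upper _ _ _ (fun i => - Y i)) => //.
  - under eq_bigr do rewrite mulrN.
    by rewrite sumrN wY oppr0.
  - by move=> i; rewrite normrN.
move=> dn; rewrite mulr2n mulrDl !mul1r; apply: le_trans (lerD up dn).
rewrite -big_split/=; apply: ler_sum => M _.
rewrite -mulrDr ler_wpM2l ?prodr_ge0// sumrN ler_normr -natrD ler_nat.
by case: (_ <= _); case: (_ <= _).
Qed.

(** * Gap-weighted occurrences and their mean over the channel *)

(* The sum, over the occurrences of [x] as a subsequence of [t], of
   [q ^+ (number of letters skipped before the last letter used)]. *)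
Fixpoint gap_sum (R : realType) (q : R) (x t : seq bool) : R :=
  match x, t with
  | [::], _ => 1
  | _ :: _, [::] => 0
  | b :: x', a :: t' => (a == b)%:R * gap_sum R q x' t' + q * gap_sum R q x t'
  end.

(** The first letter of [x] must match the head of [t], so evaluating at [drop i t] selects the
    occurrences that start at position i, counted from 0. *)
Definition pinned_gap_sum (R : realType) (q : R) (x t : seq bool) : R :=
  match x, t with
  | b :: x', a :: t' => (a == b)%:R * gap_sum R q x' t'
  | _, _ => 0
  end.

(** The expectation of [F] over a random trace of [s], revealed one source letter at a time to allow
    induction on [s]; [sum_mask_weight] identifies it with the sum over masks. *)
Fixpoint trace_mean (R : realType) (p : R) (s : seq bool) (F : seq bool -> R) : R :=
  match s with
  | [::] => F [::]
  | a :: s' => (1 - p) * trace_mean R p s' (fun t => F (a :: t))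
               + p * trace_mean R p s' F
  end.

Section TraceMean.
Context {R : realType}.
Implicit Types (p q : R) (s t x : seq bool) (F G : seq bool -> R).

Lemma eq_trace_mean p s F G : F =1 G -> trace_mean R p s F = trace_mean R p s G.
Proof.
elim: s F G => [|a s IHs] F G FG /=; first exact: FG.
rewrite (IHs F G FG); congr (_ * _ + _).
by apply: IHs => t; exact: FG.
Qed.

Lemma trace_meanD p s F G :
  trace_mean R p s (fun t => F t + G t) = trace_mean R p s F + trace_mean R p s G.
Proof. by elim: s F G => //= a s IHs F G; rewrite !IHs; ring. Qed.

Lemma trace_meanZ p s a F :
  trace_mean R p s (fun t => a * F t) = a * trace_mean R p s F.
Proof. by elim: s F => //= b s IHs F; rewrite !IHs; ring. Qed.

Lemma trace_mean_cst p s a : trace_mean R p s (fun=> a) = a.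
Proof. by elim: s => //= b s ->; ring. Qed.

Lemma mask_weight_cons p n (b : bool) (m : n.-tuple bool) :
  mask_weight p [tuple of b :: m] = (if b then 1 - p else p) * mask_weight p m.
Proof.
rewrite /mask_weight big_ord_recl /=; congr (_ * _).
by apply: eq_bigr => j _; rewrite tnthS.
Qed.

Lemma sum_tuple_cons n (G : n.+1.-tuple bool -> R) :
  \sum_m G m = \sum_(m : n.-tuple bool) G [tuple of true :: m]
             + \sum_(m : n.-tuple bool) G [tuple of false :: m].
Proof.
rewrite (reindex (fun u : bool * n.-tuple bool => [tuple of u.1 :: u.2])) /=.
  rewrite -(pair_bigA _ (fun b (m : n.-tuple bool) => G [tuple of b :: m])) /=.
  by rewrite big_bool.
exists (fun t : n.+1.-tuple bool => (thead t, [tuple of behead t])) => [[b m] _|t _] /=.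
  by congr pair; apply: val_inj.
by rewrite -tuple_eta.
Qed.

Lemma sum_mask_weight p n (s : n.-tuple bool) F :
  \sum_m mask_weight p m * F (trace_of s m) = trace_mean R p s F.
Proof.
rewrite /trace_of; elim: n s F => [|n IHn] s F.
  rewrite (tuple0 s) /= (big_pred1 [tuple]) => [|m]; last first.
    by rewrite (tuple0 m) /= eqxx.
  by rewrite /mask_weight big_ord0 mul1r.
rewrite sum_tuple_cons; case/tupleP: s => a s /=.
rewrite -2!IHn !mulr_sumr; congr (_ + _); apply: eq_bigr => m _;
  by rewrite mask_weight_cons /= mulrA.
Qed.

(* With [q = - p / (1 - p)] the factor [p + (1 - p) q] attached to each letter
   skipped inside an occurrence vanishes: only contiguous occurrences survive. *)
Lemma trace_mean_gap_sum p x s : p != 1 ->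
  trace_mean R p s (gap_sum R (- (p / (1 - p))) x)
  = (1 - p) ^+ size x * (take (size x) s == x)%:R.
Proof.
move=> p1; have p1' : 1 - p != 0 by rewrite subr_eq0 eq_sym.
elim: s x => [|a s IHs] [|b x] /=; rewrite ?mulr0 ?mul1r//.
  rewrite (IHs [::]) trace_mean_cst take0 eqxx /= expr0; ring.
rewrite trace_meanD !trace_meanZ (IHs x) (IHs (b :: x)) eqseq_cons.
rewrite -mulnb natrM exprS /=; field.
exact: p1'.
Qed.

(** Source letter j lands at trace position i when it is kept and exactly i of the j letters before
    it are kept; the contiguous match from j then has weight (1 - p)^k, which includes keeping j
    itself. *)
Lemma trace_mean_pinned p x s i : p != 1 -> (0 < size x)%N ->
  trace_mean R p s (fun t => pinned_gap_sum R (- (p / (1 - p))) x (drop i t))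
  = (1 - p) ^+ size x * \sum_(0 <= j < size s)
      'C(j, i)%:R * (1 - p) ^+ i * p ^+ (j - i) * (take (size x) (drop j s) == x)%:R.
Proof.
move=> p1; case: x => // b x _.
elim: s i => [|a s IHs] i; first by rewrite /= big_geq// mulr0.
rewrite [size (a :: s)]/= big_nat_recl//=.
case: i => [|i].
  under eq_trace_mean do rewrite drop0.
  rewrite IHs trace_meanZ trace_mean_gap_sum// eqseq_cons -mulnb natrM /=.
  rewrite mulrDr; congr (_ + _); first by rewrite exprS bin0 expr0; ring.
  rewrite mulrCA; congr (_ * _); rewrite mulr_sumr; apply: eq_bigr => j _.
  by rewrite !bin0 !subn0 exprS; ring.
(* A kept head uses up one of the [i.+1] dropped positions, a deleted head uses none; Pascal's rule
   merges the two sums. *)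
rewrite (IHs i) (IHs i.+1) bin0n /= !mul0r add0r.
rewrite mulrCA [X in _ + X]mulrCA -mulrDr; congr (_ * _).
rewrite !mulr_sumr -big_split /=; apply: eq_bigr => j _.
rewrite binS natrD subSS.
(* For j <= i the truncated exponent [j - i.+1] is off by one, but its coefficient ['C(j, i.+1)] is
   0. *)
have [ji|ij] := leqP j i.
  by rewrite (@bin_small j i.+1 ji) exprS; ring.
by rewrite -(subnSK ij) !exprS; ring.
Qed.

(** The bound V_m = (1 - |q|)^(-m) solves V_(m+1) = V_m + |q| V_(m+1), the recursion of [gap_sum]
    when every letter matches. *)
Lemma gap_sum_bound q x t : `|q| < 1 ->
  `|gap_sum R q x t| <= (1 - `|q|) ^- size x.
Proof.
move=> q1; have q0 : 0 < 1 - `|q| by rewrite subr_gt0.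
elim: t x => [|a t IHt] [|b x] /=; rewrite ?expr0 ?invr1 ?normr1 ?normr0//.
  by rewrite invr_ge0 exprn_ge0// ltW.
apply: le_trans (ler_normD _ _) _.
rewrite !normrM; apply: (@le_trans _ _
  ((1 - `|q|) ^- size x + `|q| * (1 - `|q|) ^- (size x).+1)).
  apply: lerD; last by rewrite ler_wpM2l// (IHt (b :: x)).
  case: eqP => _; rewrite ?normr1 ?mul1r// normr0 mul0r.
  by rewrite invr_ge0 exprn_ge0// ltW.
rewrite le_eqVlt; apply/orP; left; apply/eqP.
rewrite !exprS; field.
by rewrite expf_neq0 ?gt_eqF.
Qed.

Lemma pinned_gap_sum_bound q x t : `|q| < 1 ->
  `|pinned_gap_sum R q x t| <= (1 - `|q|) ^- size x.
Proof.
move=> q1; have q0 : 0 < 1 - `|q| by rewrite subr_gt0.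
have V0 m : 0 <= (1 - `|q|) ^- m by rewrite invr_ge0 exprn_ge0// ltW.
case: x t => [|b x] [|a t] /=; rewrite ?normr0//.
case: eqP => _; rewrite ?mul0r ?normr0// mul1r.
apply: le_trans (gap_sum_bound _ x t q1) _.
rewrite lef_pV2 ?posrE ?exprn_gt0// exprS ler_piMl//.
by rewrite exprn_ge0// ltW.
Qed.

End TraceMean.

(** * The estimator: unbiasedness, boundedness, concentration *)

Definition kmer_estimator (R : realType) (p : R) (x : seq bool) (i : nat)
    (t : seq bool) : R :=
  (1 - p) ^- size x * pinned_gap_sum R (- (p / (1 - p))) x (drop (i - 1) t).

Definition sample_mean (R : realType) (X : seq bool -> R) (tr : seq (seq bool)) : R :=
  (\sum_(t <- tr) X t) / (size tr)%:R.

Section Estimator.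
Context {R : realType}.
Implicit Types (p : R).

Lemma mask_weight_ge0 p n (m : n.-tuple bool) : 0 <= p <= 1 -> 0 <= mask_weight p m.
Proof.
move=> /andP[p0 p1]; apply: prodr_ge0 => j _.
by case: (tnth m j); rewrite ?subr_ge0.
Qed.

Lemma mask_weight_sum1 p n : \sum_(m : n.-tuple bool) mask_weight p m = 1.
Proof.
have := sum_mask_weight p n [tuple of nseq n true] (fun=> 1).
by rewrite trace_mean_cst; under eq_bigr do rewrite mulr1.
Qed.

Lemma kmer_estimator_mean p n k (s : n.-tuple bool) (x : k.-tuple bool) i :
  p != 1 -> (0 < k)%N -> (0 < i)%N ->
  \sum_m mask_weight p m * kmer_estimator R p x i (trace_of s m)
  = kmer_density p s x i.
Proof.
move=> p1 k0 i0.
rewrite sum_mask_weight trace_meanZ trace_mean_pinned ?size_tuple// mulKf; last first.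
  by rewrite expf_neq0// subr_eq0 eq_sym.
rewrite /kmer_density big_add1 /=.
(* The extra indices n + 1 - k <= j < n leave fewer than k letters, so the window there cannot equal
   [x]. *)
have le_n : (n.+1 - k <= n)%N by rewrite leq_subLR -add1n leq_add2r.
rewrite (big_cat_nat _ le_n)//= [X in _ + X = _]big_nat_cond.
rewrite [X in _ + X = _]big1 ?addr0 => [|j].
  by apply: eq_bigr => j _; rewrite !subn1 /= -[in RHS](prednK i0) subSS.
move=> /andP[/andP[jl ju] _].
case: eqP => [jx|_]; last by rewrite mulr0.
have := congr1 size jx; rewrite size_take size_drop !size_tuple.
by case: (ltnP k (n - j)) => ? ?; exfalso; lia.
Qed.

Lemma kmer_estimator_bound p (x : seq bool) i t : 0 < p -> p < 1 / 2 ->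
  `|kmer_estimator R p x i t| <= (1 - 2 * p) ^- size x.
Proof.
move=> p0 p12; have p1 : 0 < 1 - p by lra.
have q1 : `|- (p / (1 - p))| = p / (1 - p).
  by rewrite normrN gtr0_norm// divr_gt0.
have := pinned_gap_sum_bound (- (p / (1 - p))) x (drop (i - 1) t).
rewrite q1 ltr_pdivrMr// => /(_ _)/wrap[|hb]; first lra.
have V0 : 0 <= (1 - p) ^- size x by rewrite invr_ge0 exprn_ge0// ltW.
rewrite normrM ger0_norm//.
have -> : 1 - 2 * p = (1 - p) * (1 - p / (1 - p)) by field; rewrite gt_eqF.
by rewrite exprMn invfM ler_wpM2l.
Qed.

(** Centring at the mean doubles the range to 2 W, whence 4 (2 W)^2 = 16 W^2 in the tail. *)
Lemma trace_prob_deviation p n (s : n.-tuple bool) (X : seq bool -> R) (W eps : R) T :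
  0 <= p <= 1 -> 0 < W -> (forall t, `|X t| <= W) -> 0 < eps ->
  trace_prob p T s (fun tr => ~~ (`|sample_mean R X tr
      - \sum_m mask_weight p m * X (trace_of s m)| < eps))
  <= 2 * expR (- (T%:R * eps ^+ 2 / (16 * W ^+ 2))).
Proof.
move=> p01 W0 XW e0; set mu := \sum_m _.
have w0 (m : n.-tuple bool) : 0 <= mask_weight p m by exact: mask_weight_ge0.
have muW : `|mu| <= W.
  apply: le_trans (ler_norm_sum _ _ _) _.
  rewrite -[leRHS]mul1r -(mask_weight_sum1 p n) mulr_suml.
  by apply: ler_sum => m _; rewrite normrM ger0_norm// ler_wpM2l.
have := @hoeffding R (n.-tuple bool) (fun m => mask_weight p m)
 (fun m => X (trace_of s m) - mu) (2 * W)
  eps T w0 (mask_weight_sum1 p n).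
have -> : 4 * (2 * W) ^+ 2 = 16 * W ^+ 2 by ring.
move=> H; apply: le_trans (H _ _ _ e0); last 1 first.
- by move=> m; apply: le_trans (ler_normB _ _) _; rewrite mulr2n mulrDl mul1r lerD.
- rewrite /trace_prob; apply: ler_sum => M _.
  rewrite ler_wpM2l ?prodr_ge0// ler_nat.
  rewrite -leNgt /sample_mean /traces_of big_map size_map size_enum_ord.
  rewrite big_enum /= sumrB sumr_const card_ord.
  case: (leP eps) => //= he.
  (* For T = 0 the Hoeffding event reads 0 <= |...| and always holds. *)
  have [T0|T0] := posnP T.
    by rewrite (_ : T%:R = 0 :> R) ?mul0r ?normr_ge0// T0.
  have T0' : 0 < T%:R :> R by rewrite ltr0n.
  rewrite (_ : _ - _ = T%:R * (\sum_(t < T) X (trace_of s (M t)) / T%:R - mu));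
    last first.
    by rewrite -mulr_suml mulrBr mulrC divfK ?gt_eqF// mulr_natl.
  by rewrite normrM gtr0_norm// -mulr_suml ler_pM2l// he.
- under eq_bigr do rewrite mulrBr.
  by rewrite sumrB -mulr_suml mask_weight_sum1 mul1r subrr.
- by rewrite mulr_gt0.
Qed.

(** Checked for each [M] separately: either all events hold or some failure indicator equals 1. *)
Lemma trace_prob_union p n T (s : n.-tuple bool) (I : finType)
    (E : I -> seq (seq bool) -> bool) : 0 <= p <= 1 ->
  1 - \sum_i trace_prob p T s (fun tr => ~~ E i tr)
  <= trace_prob p T s (fun tr => [forall i, E i tr]).
Proof.
move=> p01.
have tot : \sum_(M : {ffun 'I_T -> n.-tuple bool}) \prod_(t < T) mask_weight p (M t) = 1.
  rewrite -(bigA_distr_bigA (fun _ m => mask_weight p m)).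
  by rewrite prodr_const mask_weight_sum1 expr1n.
rewrite lerBlDr -[leLHS]tot /trace_prob exchange_big /= -big_split /=.
apply: ler_sum => M _; rewrite -mulr_sumr -mulrDr.
rewrite ler_peMr ?prodr_ge0// => [t _|]; first exact: mask_weight_ge0.
case: forallP => [_|/forallP].
  by rewrite lerDl sumr_ge0.
rewrite negb_forall => /existsP[i Ei].
by rewrite add0r (bigD1 i)//= Ei lerDl sumr_ge0.
Qed.

Lemma f_c_ge p c n k : 0 < p -> p < 1 / 2 -> (1 < n)%N ->
  k%:R = c * log2 n%:R ->
  16 * ((1 - 2 * p) ^- k) ^+ 2 <= f_c c p n.
Proof.
move=> p0 p12 n1 kE.
have ln2 : ln 2 != 0 :> R by rewrite gt_eqF// ln_gt0// ltr1n.
have n0 : 0 < n%:R :> R by rewrite ltr0n ltnW.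
have nn0 : n%:R != 0 :> R by rewrite gt_eqF.
have p1 : 0 < 1 - p by lra.
have d0 : 0 < 1 - 2 * p by lra.
have clnn : c * ln n%:R = k%:R * ln 2 by rewrite kE /log2; field.
have powE (e : R) : n%:R `^ e = expR (e * ln n%:R).
  by rewrite /powR (negPf nn0).
have lnVX (y : R) : 0 < y -> expR (k%:R * ln y) = y ^+ k.
  by move=> y0; rewrite expRM_natl lnK// posrE.
have l1r : ln (1 - p / (1 - p)) = ln (1 - 2 * p) - ln (1 - p).
  by rewrite -ln_div ?posrE//; congr ln; field; rewrite gt_eqF.
have lr : ln (p / (1 - p)) = ln p - ln (1 - p) by rewrite ln_div ?posrE.
have den : n%:R `^ (2 * c * log2 (1 - p) - 1) = (1 - p) ^+ k ^+ 2 / n%:R.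
  rewrite powE -lnVX// -expRM_natl -[X in _ / X](lnK n0) -expRN -expRD.
  congr expR; rewrite mulrBl mul1r; congr (_ - _).
  rewrite /log2 (_ : 2 * c * (ln (1 - p) / ln 2) * _
    = 2 * (c * ln n%:R) * (ln (1 - p) / ln 2)); last by ring.
  by rewrite clnn; field.
(* With r = p / (1 - p), H(1 - r) + log2 r = (1 - r) log2 (r / (1 - r)), so alpha_c collapses to 1 -
   c log2 (1 - r), where 1 - r = (1 - 2 p) / (1 - p). *)
have al : n%:R `^ alpha_c c p = n%:R * ((1 - p) ^+ k / (1 - 2 * p) ^+ k).
  rewrite powE -!lnVX// -[X in _ = X * _](lnK n0) -expRN -!expRD; congr expR.
  rewrite /alpha_c /Hbin /log2 subKr lr l1r ln_div ?posrE//.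
  have -> (A B C D : R) : (1 + c * A + (c * B + c * C) / D) * ln n%:R =
     ln n%:R + (c * ln n%:R) * A + ((c * ln n%:R) * (B + C)) / D by ring.
  rewrite clnn; field.
  by rewrite ln2 /=; apply/andP; split; rewrite gt_eqF//; lra.
rewrite /f_c den al.
set a := (1 - p) ^+ k; set d := (1 - 2 * p) ^+ k.
have a0 : 0 < a by rewrite exprn_gt0.
have d0' : 0 < d by rewrite exprn_gt0.
have -> : (1 + 2 * (n%:R * (a / d))) ^+ 2 / (2 * (a ^+ 2 / n%:R)) =
   2 * n%:R ^+ 3 * d^-1 ^+ 2 + n%:R * (1 + 4 * (n%:R * (a / d))) / (2 * a ^+ 2).
  by field; rewrite nn0 !gt_eqF.
have r0 : 0 <= n%:R * (1 + 4 * (n%:R * (a / d))) / (2 * a ^+ 2).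
  rewrite divr_ge0 ?mulr_ge0 ?ltW ?exprn_gt0// addr_gt0// !mulr_gt0// invr_gt0//.
(* n >= 2 turns the leading term 2 n^3 / d^2 into 16 / d^2. *)
have n8 : 8 <= n%:R ^+ 3 :> R.
  by rewrite -natrX ler_nat (@leq_exp2r 2 n 3).
have dd : 0 <= d^-1 ^+ 2 by rewrite sqr_ge0.
have : 0 <= (n%:R ^+ 3 - 8) * d^-1 ^+ 2 by rewrite mulr_ge0 ?subr_ge0.
lra.
Qed.

End Estimator.

(** * From tail bounds to the sample sizes *)

Section SampleComplexity.
Context {R : realType}.

(** The level [A] is left free to serve both claims: 2 / delta for one entry and 2 n^(1+c) / delta
    for the whole map. The hypothesis on [T] gives T eps^2 >= 16 W^2 ln A, so the tail is at most 2
    / A. *)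
Lemma trace_prob_kmer_failure (p c : R) (n k T : nat) (s : n.-tuple bool)
    (x : k.-tuple bool) (i : nat) (eps A : R) :
  0 < p -> p < 1 / 2 -> (1 < n)%N -> (0 < k)%N -> (0 < i)%N ->
  k%:R = c * log2 n%:R -> 0 < eps -> 1 <= A ->
  ln A * eps ^-2 * f_c c p n <= T%:R ->
  trace_prob p T s (fun tr => ~~ (`|sample_mean R (kmer_estimator R p x i) tr
      - kmer_density p s x i| < eps)) <= 2 / A.
Proof.
move=> p0 p12 n1 k0 i0 kE e0 A1 hT.
have A0 : 0 < A by exact: lt_le_trans A1.
have d0 : 0 < 1 - 2 * p by lra.
have W0 : 0 < (1 - 2 * p) ^- k by rewrite invr_gt0 exprn_gt0.
have p01 : 0 <= p <= 1 by apply/andP; split; lra.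
rewrite -(kmer_estimator_mean p n k s x i) ?lt_eqF//; last by lra.
have XW t : `|kmer_estimator R p x i t| <= (1 - 2 * p) ^- k.
  by have := kmer_estimator_bound p x i t p0 p12; rewrite size_tuple.
apply: le_trans (trace_prob_deviation p n s _ _ _ T p01 W0 XW e0) _.
rewrite ler_wpM2l// -[leRHS]lnK ?posrE ?invr_gt0// lnV ?posrE// ler_expR lerN2.
rewrite ler_pdivlMr ?mulr_gt0 ?exprn_gt0//.
apply: (@le_trans _ _ (ln A * f_c c p n)).
  by rewrite ler_wpM2l ?ln_ge0// (f_c_ge p c n k).
rewrite -ler_pdivrMr ?exprn_gt0//; apply: le_trans hT.
by rewrite mulrAC.
Qed.

Lemma le_trace_prob (p : R) n T (s : n.-tuple bool) (E E' : seq (seq bool) -> bool) :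
  0 <= p <= 1 -> (forall tr, E tr -> E' tr) ->
  trace_prob p T s E <= trace_prob p T s E'.
Proof.
move=> p01 EE; apply: ler_sum => M _.
rewrite ler_wpM2l ?prodr_ge0// => [t _|]; first exact: mask_weight_ge0.
by rewrite ler_nat; case: (E _) (EE (traces_of s M)) => // ->.
Qed.

End SampleComplexity.

Theorem theorem1 (R : realType) (p c : R) (n k : nat) :
  0 < p -> p < 1 / 2 -> 0 < c ->
  k%:R = c * log2 n%:R -> (2 <= k)%N ->
  (* (1) estimator of a single entry K_{s,x}[i] *)
  (forall (x : k.-tuple bool) (i : nat), (1 <= i <= n.+1 - k)%N ->
     exists est : seq (seq bool) -> R,
       forall (s : n.-tuple bool) (eps delta : R) (T : nat),
         0 < eps -> 0 < delta < 1 ->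
         ln (2 / delta) * eps ^-2 * f_c c p n <= T%:R ->
         trace_prob p T s
           (fun tr => `|est tr - kmer_density p s x i| < eps) >= 1 - delta)
  /\
  (* (2) estimator of the whole k-mer density map, sup-norm error *)
  (exists est : seq (seq bool) -> k.-tuple bool -> nat -> R,
     forall (s : n.-tuple bool) (eps delta : R) (T : nat),
       0 < eps -> 0 < delta < 1 ->
       ln (2 * n%:R `^ (1 + c) / delta) * eps ^-2 * f_c c p n <= T%:R ->
       trace_prob p T s
         (fun tr => [forall x : k.-tuple bool, forall i : 'I_(n.+1 - k),
                       `|est tr x i.+1 - kmer_density p s x i.+1| < eps])
         >= 1 - delta).
Proof.
move=> p0 p12 c0 kE k2.
have k0 : (0 < k)%N by exact: ltnW.
have p01 : 0 <= p <= 1 by apply/andP; split; lra.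
(* For n <= 1 the logarithm is at most 0 ([ln 0] being 0), contradicting k > 0. *)
have n1 : (1 < n)%N.
  have : 0 < k%:R :> R by rewrite ltr0n.
  rewrite kE pmulr_rgt0// /log2 => h.
  rewrite ltnNge; apply/negP => n_le1.
  have : ln n%:R <= 0 :> R by apply: ln_le0; rewrite lern1.
  move=> lnn; have : ln n%:R / ln 2 <= 0 :> R.
    by rewrite mulr_le0_ge0// invr_ge0 ln_ge0// ler1n.
  by rewrite leNgt h.
have nR0 : 0 < n%:R :> R by rewrite ltr0n ltnW.
have nR1 : 1 <= n%:R :> R by rewrite ler1n ltnW.
split.
  move=> x i /andP[i0 _]; exists (sample_mean R (kmer_estimator R p x i)).
  move=> s eps delta T e0 /andP[d0 d1] hT.
  have A1 : 1 <= 2 / delta by rewrite ler_pdivlMr//; lra.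
  have fail := trace_prob_kmer_failure p c n k T s x i eps _ p0 p12 n1 k0 i0 kE e0 A1 hT.
  have -> : 1 - delta = 1 - 2 / (2 / delta) by field; rewrite gt_eqF.
  (* A union bound over one event passes from failure to success probability. *)
  have := trace_prob_union p n T s unit (fun _ tr =>
    `|sample_mean R (kmer_estimator R p x i) tr - kmer_density p s x i| < eps) p01.
  rewrite sumr_const card_unit => union.
  apply: (@le_trans _ _ _ _ _ _ (le_trans union _)); first by rewrite lerB.
  by apply: le_trace_prob => // tr /forallP /(_ tt).
exists (fun tr x i => sample_mean R (kmer_estimator R p x i) tr).
move=> s eps delta T e0 /andP[d0 d1] hT.
have N1 : 1 <= n%:R `^ (1 + c).
  by rewrite -[leLHS](powRr0 n%:R) ler_powR//; lra.
have N0 : 0 < n%:R `^ (1 + c) by exact: lt_le_trans N1.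
have A1 : 1 <= 2 * n%:R `^ (1 + c) / delta by rewrite ler_pdivlMr//; lra.
(* Since 2^k = n^c, this dominates the number 2^k (n + 1 - k) of entries, each failing with
   probability at most delta / n^(1+c). *)
have NE : n%:R `^ (1 + c) = n%:R * 2 ^+ k.
  rewrite powRD ?(gt_eqF nR0) ?implybT// powRr1 ?(ltW nR0)//; congr (_ * _).
  rewrite /powR (gt_eqF nR0) -[2 in RHS]lnK ?posrE// -expRM_natl kE /log2.
  by congr expR; rewrite -mulrA divfK// gt_eqF// ln_gt0// ltr1n.
have := trace_prob_union p n T s (k.-tuple bool * 'I_(n.+1 - k))%type
  (fun xi tr => `|sample_mean R (kmer_estimator R p xi.1 xi.2.+1) tr
     - kmer_density p s xi.1 xi.2.+1| < eps) p01.
move=> union; apply: le_trans (le_trans _ union) _; last first.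
  apply: le_trace_prob => // tr /forallP h.
  by apply/forallP => x; apply/forallP => i; exact: (h (x, i)).
rewrite lerB//.
apply: (@le_trans _ _ (\sum_(xi : k.-tuple bool * 'I_(n.+1 - k))
    2 / (2 * n%:R `^ (1 + c) / delta))).
  apply: ler_sum => -[x i] _ /=.
  exact: (trace_prob_kmer_failure p c n k T s x i.+1 eps _ p0 p12 n1 k0 _ kE e0 A1 hT).
rewrite sumr_const card_prod card_tuple card_bool card_ord.
have -> : 2 / (2 * n%:R `^ (1 + c) / delta) = delta / n%:R `^ (1 + c).
  by field; rewrite !gt_eqF.
rewrite -(mulr_natr (delta / _)) mulrAC ler_pdivrMr// ler_wpM2l ?(ltW d0)// NE.
rewrite natrM natrX mulrC ler_wpM2r ?exprn_ge0// ler_nat.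
by rewrite leq_subLR -add1n leq_add2r.
Qed.
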